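(* Let $K$ be a perfect field, $d\ge 2$, let $V_1,\dots,V_d$ be finite-dimensional $K$-vector spaces with fixed bases, $V=V_1\otimes\cdots\otimes V_d$ and $v\in V$. Then $$\operatorname{rk}^T(v)\ge\frac{2}{d}\operatorname{srk}^T(v),$$ and therefore $$\operatorname{rk}^G(v)\ge\frac{2}{d}\operatorname{srk}(v).$$
   Context: Let $n_i=\dim V_i$ and denote the fixed basis of $V_i$ by $[1],\dots,[n_i]$. Valuation: for a $K$-vector space $W$ and $v(t)\in K((t))\otimes W$, $\operatorname{val}_t(v(t))$ is the largest integer $m$ with $v(t)\in t^m(K[[t]]\otimes W)$, and $\operatorname{val}_t(0)=\infty$. Let $\mathrm{GL}(V_i,K[[t]])$ be the set of elements of $K[[t]]\otimes\operatorname{End}(V_i)$ invertible over $K((t))$ (the inverse need not have entries in $K[[t]]$), and $G(K[[t]])=\prod_i\mathrm{GL}(V_i,K[[t]])$, acting on $K((t))\otimes V$ factorwise. For $g(t)\in G(K[[t]])$ with $\operatorname{val}_t(g(t)\cdot v)>0$ put $\mu(g(t),v)=\dfrac{\sum_{i=1}^d\operatorname{val}_t(\det g_i(t))}{\operatorname{val}_t(g(t)\cdot v)}$ (a quotient with denominator $\infty$ is $0$). $G$-stable rank: $\operatorname{rk}^G(v)$ is the infimum of $\mu(g(t),v)$ over all $g(t)\in G(K[[t]])$ with $\operatorname{val}_t(g(t)\cdot v)>0$. $T$-stable rank: $\operatorname{rk}^T(v)$ is the infimum of $\mu(\lambda(t),v)$ over all $\lambda(t)=(\lambda_1(t),\dots,\lambda_d(t))$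 with $\operatorname{val}_t(\lambda(t)\cdot v)>0$ such that each $\lambda_i(t)$ is diagonal in the fixed basis of $V_i$ with diagonal entries $t^{x(i,1)},\dots,t^{x(i,n_i)}$, $x(i,j)$ nonnegative integers. Slice rank: a nonzero tensor has slice rank $1$ if it lies in $V_1\otimes\cdots\otimes V_{i-1}\otimes w\otimes V_{i+1}\otimes\cdots\otimes V_d$ for some $i$ and some $w\in V_i$; $\operatorname{srk}(v)$ is the smallest $r\ge0$ such that $v$ is a sum of $r$ tensors of slice rank $1$. $T$-slice rank: a tensor has $T$-slice rank $1$ if it lies in $V_{i,j}=V_1\otimes\cdots\otimes V_{i-1}\otimes[j]\otimes V_{i+1}\otimes\cdots\otimes V_d$ for some $i$ and some $j\in\{1,\dots,n_i\}$; $\operatorname{srk}^T(v)$ is the smallest $r\ge0$ such that $v$ is a sum of $r$ tensors of $T$-slice rank $1$. *)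

(* Defs.v *)
From HB Require Import structures.
From mathcomp Require Import all_boot all_order all_algebra all_field.
From mathcomp Require Import boolp classical_sets constructive_ereal reals ereal.
Set Implicit Arguments.
Unset Strict Implicit.
Unset Printing Implicit Defensive.

Import Order.TTheory GRing.Theory Num.Theory.
Local Open Scope ring_scope.
Local Open Scope classical_set_scope.

Definition perfect_field (K : fieldType) : Prop :=
  forall p : {poly K}, irreducible_poly p -> separable_poly p.

(* The value 0 at A = set0 is irrelevant: see srkP and srkTP below. *)
Definition least (A : set nat) : nat :=
  xget 0%N [set r | A r /\ forall m, A m -> (r <= m)%N].

Lemma leastP (A : set nat) : A !=set0 ->
  A (least A) /\ forall m, A m -> (least A <= m)%N.
Proof.
move=> [a Aa]; pose P r : Prop := A r /\ forall m, A m -> (r <= m)%N.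
suff [r Pr] : exists r, P r by exact: (xgetI 0%N Pr).
have exA : exists n, `[< A n >] by exists a; apply/asboolP.
case: (ex_minnP exA) => r /asboolP Ar rmin; exists r; split=> // m Am.
by apply: rmin; apply/asboolP.
Qed.

(* K[[t]]; the power series with coefficient sequence a is Fps a. *)

Record fps (K : fieldType) := Fps { coefs : nat -> K }.

HB.instance Definition _ (K : fieldType) := gen_eqMixin (fps K).
HB.instance Definition _ (K : fieldType) := gen_choiceMixin (fps K).

Section PowerSeries.
Variable K : fieldType.
Implicit Types f g h : fps K.

Lemma fpsP f g : coefs f =1 coefs g -> f = g.
Proof. by case: f; case: g => /= a b /funext ->. Qed.

Definition fpsC (c : K) := Fps (fun n => if n == 0%N then c else 0).
Definition fpsX : fps K := Fps (fun n => (n == 1%N)%:R).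

Definition fps_add f g := Fps (fun n => coefs f n + coefs g n).
Definition fps_opp f := Fps (fun n => - coefs f n).
Definition fps_mul f g :=
  Fps (fun n => \sum_(i < n.+1) coefs f i * coefs g (n - i)%N).

Fact fps_addA : associative fps_add.
Proof. by move=> f g h; apply: fpsP => n /=; rewrite addrA. Qed.
Fact fps_addC : commutative fps_add.
Proof. by move=> f g; apply: fpsP => n /=; rewrite addrC. Qed.
Fact fps_add0 : left_id (fpsC 0) fps_add.
Proof. by move=> f; apply: fpsP => n /=; rewrite if_same add0r. Qed.
Fact fps_addN : left_inverse (fpsC 0) fps_opp fps_add.
Proof. by move=> f; apply: fpsP => n /=; rewrite if_same addNr. Qed.

HB.instance Definition _ :=
  GRing.isZmodule.Build (fps K) fps_addA fps_addC fps_add0 fps_addN.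

Definition fps_trunc N f : {poly K} := \poly_(i < N.+1) coefs f i.

Lemma coef_trunc N f i : (i <= N)%N -> (fps_trunc N f)`_i = coefs f i.
Proof. by move=> iN; rewrite coef_poly ltnS iN. Qed.

Lemma coefs_mul N f g n : (n <= N)%N ->
  coefs (fps_mul f g) n = (fps_trunc N f * fps_trunc N g)`_n.
Proof.
move=> nN; rewrite coefM /=; apply: eq_bigr => i _.
rewrite !coef_trunc ?(leq_trans (leq_subr _ _)) //.
by rewrite (leq_trans _ nN) // -ltnS.
Qed.

Fact fps_mulC : commutative fps_mul.
Proof.
by move=> f g; apply: fpsP => n; rewrite !(coefs_mul _ _ (leqnn n)) mulrC.
Qed.

Fact fps_mulA : associative fps_mul.
Proof.
have mul3 f g h n : coefs (fps_mul f (fps_mul g h)) n =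
    (fps_trunc n f * (fps_trunc n g * fps_trunc n h))`_n.
  rewrite coefM /=; apply: eq_bigr => i _.
  by rewrite -coefs_mul ?leq_subr // coef_trunc // -ltnS.
move=> f g h; apply: fpsP => n.
rewrite [RHS](congr1 (fun s => coefs s n) (fps_mulC _ _)) !mul3.
by rewrite mulrA mulrC.
Qed.

Fact fps_mul1 : left_id (fpsC 1) fps_mul.
Proof.
move=> f; apply: fpsP => n /=; rewrite big_ord_recl /= mul1r subn0.
by rewrite big1 ?addr0 // => i _; rewrite mul0r.
Qed.

Fact fps_mulD : left_distributive fps_mul fps_add.
Proof.
move=> f g h; apply: fpsP => n /=; rewrite -big_split /=.
by apply: eq_bigr => i _; rewrite mulrDl.
Qed.

Fact fps_1neq0 : fpsC 1 != 0.
Proof.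
by apply/eqP => /(congr1 (fun f => coefs f 0%N)) /= /eqP; rewrite oner_eq0.
Qed.

HB.instance Definition _ := GRing.Zmodule_isComNzRing.Build (fps K)
  fps_mulA fps_mulC fps_mul1 fps_mulD fps_1neq0.

Definition fps_unit : {pred fps K} := [pred f | `[< exists g, g * f = 1 >]].
Definition fps_inv f := xget f [set g | g * f = 1].

Fact fps_mulV : {in fps_unit, left_inverse 1 fps_inv *%R}.
Proof.
move=> f /asboolP[g gf1].
exact: (@xgetI _ f [set h | h * f = 1] g).
Qed.
Fact fps_unitPl f g : g * f = 1 -> fps_unit f.
Proof. by move=> gf1; apply/asboolP; exists g. Qed.
Fact fps_inv_out : {in [predC fps_unit], fps_inv =1 id}.
Proof.
move=> f; rewrite !inE => /asboolPn nf.
by rewrite /fps_inv; case: xgetP => // g _ gf1; case: nf; exists g.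
Qed.

HB.instance Definition _ := GRing.ComNzRing_hasMulInverse.Build (fps K)
  fps_mulV fps_unitPl fps_inv_out.

Lemma fps_order f : f != 0 ->
  exists a, coefs f a != 0 /\ forall i, (i < a)%N -> coefs f i = 0.
Proof.
move=> f0; have exf : exists a, coefs f a != 0.
  apply: contrapT => /forallNP f_0; case/eqP: f0; apply: fpsP => n /=.
  by rewrite if_same; apply/eqP/negPn/negP/f_0.
case: (ex_minnP exf) => a fa amin; exists a; split=> // i ia.
by apply/eqP; apply: contraLR ia => /amin; rewrite -leqNgt.
Qed.

Fact fps_idomain : GRing.integral_domain_axiom (fps K).
Proof.
move=> f g fg0; apply/negPn; rewrite negb_or; apply/negP => /andP[].
move=> /fps_order[a [fa fi]] /fps_order[b [gb gi]].
have /eqP := congr1 (fun h => coefs h (a + b)%N) fg0.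
have aab : (a < (a + b).+1)%N by rewrite ltnS leq_addr.
rewrite /= (bigD1 (Ordinal aab)) //= addKn big1 ?addr0 ?if_same; last first.
  move=> i /eqP ia; have [ltia|leai] := ltnP i a; first by rewrite fi ?mul0r.
  have ltai : (a < i)%N.
    by rewrite ltn_neqAle leai andbT; apply/eqP => E; apply: ia; apply: val_inj.
  by rewrite gi ?mulr0 // ltn_subLR ?ltn_add2r // -ltnS.
by apply/negP; rewrite mulf_neq0.
Qed.

HB.instance Definition _ := GRing.ComUnitRing_isIntegral.Build (fps K) fps_idomain.

Lemma coefsD f g n : coefs (f + g) n = coefs f n + coefs g n. Proof. by []. Qed.
Lemma coefsM f g n :
  coefs (f * g) n = \sum_(i < n.+1) coefs f i * coefs g (n - i)%N.
Proof. by []. Qed.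

Lemma fps_unit0 f : coefs f 0%N != 0 -> exists g, g * f = 1.
Proof.
move=> f0; pose c := fpsC (coefs f 0%N)^-1.
have [h [h0 cfE]] : exists h, coefs h 0%N = 0 /\ c * f = 1 - h.
  exists (1 - c * f); rewrite opprB addrCA subrr addr0; split=> //.
  by rewrite coefsD /= big_ord_recl big_ord0 /= addr0 mulVf // subrr.
have hX k j : (j < k)%N -> coefs (h ^+ k) j = 0.
  elim: k j => // k IH j jk; rewrite exprS coefsM big1 // => -[[|i] ij] _ /=.
    by rewrite h0 mul0r.
  by rewrite IH ?mulr0 // ltn_subLR // (leq_trans jk) // addSn ltnS leq_addl.
pose S N := \sum_(k < N.+1) h ^+ k.
pose g := Fps (fun n => coefs (S n) n).
have gS N n : (n <= N)%N -> coefs g n = coefs (S N) n.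
  elim: N => [|N IH]; first by rewrite leqn0 => /eqP ->.
  rewrite leq_eqVlt ltnS => /predU1P[-> //|nN].
  by rewrite /S big_ord_recr coefsD [X in _ + X]hX ?ltnS // addr0 IH.
exists (g * c); rewrite -mulrA cfE.
apply: fpsP => n; transitivity (coefs (S n * (1 - h)) n).
  by rewrite !coefsM; apply: eq_bigr => i _; rewrite (gS n) // -ltnS.
have -> : S n * (1 - h) = 1 - h ^+ n.+1.
  by rewrite -[RHS]opprB subrX1 -mulNr opprB mulrC.
have -> f1 f2 : coefs (f1 - f2) n = coefs f1 n - coefs f2 n by [].
by rewrite hX // subr0.
Qed.

Lemma coefs_mulXn k f n :
  coefs (fpsX ^+ k * f) n = if (n < k)%N then 0 else coefs f (n - k).
Proof.
elim: k f n => [|k IH] f n; first by rewrite expr0 mul1r subn0.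
rewrite exprS -mulrA coefsM; case: n => [|n].
  by rewrite big_ord_recl big_ord0 /= mul0r addr0.
rewrite 2!big_ord_recl big1 /= ?mul0r ?mul1r ?add0r ?addr0; last first.
  by move=> i _; rewrite mul0r.
by rewrite /bump /= subn1 /= -coefsM IH ltnS subSS.
Qed.

Lemma fps_factor f : f != 0 ->
  exists a u, coefs u 0%N != 0 /\ f = fpsX ^+ a * u.
Proof.
move=> /fps_order[a [fa fi]]; exists a, (Fps (fun n => coefs f (n + a)%N)).
split=> //; apply: fpsP => n; rewrite coefs_mulXn.
by case: ltnP => [/fi|an] //=; rewrite subnK.
Qed.

Lemma fpsX_neq0 : fpsX != 0.
Proof.
by apply/eqP => /(congr1 (fun f => coefs f 1%N)) /= /eqP; rewrite oner_eq0.
Qed.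

End PowerSeries.

(* K((t)) *)
Notation laurent K := {fraction (fps K)}.
Notation "x %:F" := (@FracField.tofrac _ x) : ring_scope.

Lemma laurent_frac (K : fieldType) (x : laurent K) :
  exists p q : fps K, q != 0 /\ x = p%:F / q%:F.
Proof.
elim/quotW: x => y; exists y.1, y.2; have y2 := denom_ratioP y.
split=> //; apply: (canRL (mulfK _)); first by rewrite tofrac_eq0.
unlock FracField.tofrac; rewrite -[LHS]FracField.pi_mul /FracField.mulf.
apply/eqmodP; rewrite /= /equivf /=.
by rewrite !numden_Ratio ?mulf_neq0 ?oner_eq0 // !mulr1 mulrC.
Qed.

Lemma laurent_factor (K : fieldType) (x : laurent K) : x != 0 ->
  exists (c : int) (u : fps K),
    coefs u 0%N != 0 /\ x = (fpsX K)%:F ^ c * u%:F.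
Proof.
have [p [q [q0 ->]]] := laurent_frac x => pq0.
have p0 : p != 0.
  by apply: contraNneq pq0 => ->; rewrite tofrac0 mul0r.
have X0 : (fpsX K)%:F != 0 by rewrite tofrac_eq0 fpsX_neq0.
have [a [u [u0 ->]]] := fps_factor p0; have [b [w [w0 ->]]] := fps_factor q0.
have [w' w1] := fps_unit0 w0.
have wF : (w%:F)^-1 = w'%:F.
  have wF0 : w%:F != 0.
    by rewrite tofrac_eq0; apply: contraNneq w0 => ->.
  by apply: (mulIf wF0); rewrite mulVf // -tofracM w1 tofrac1.
exists (a%:Z - b%:Z), (u * w'); split.
  rewrite coefsM big_ord_recl big_ord0 addr0 mulf_neq0 //=.
  have := congr1 (fun f => coefs f 0%N) w1.
  rewrite coefsM big_ord_recl big_ord0 addr0 /= subnn => /eqP w01.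
  by apply: contraTneq w01 => ->; rewrite mul0r eq_sym oner_eq0.
rewrite !tofracM !tofracXn invfM wF expfzDr // -exprnN -exprnP.
by rewrite mulrACA.
Qed.

Section Valuation.
Variables (K : fieldType) (I : finType).
Implicit Types w : {ffun I -> laurent K}.

(* t^m (K[[t]] (x) W), where W = K^I *)
Definition lattice (m : int) : set {ffun I -> laurent K} :=
  [set w | exists s : I -> fps K, forall a, w a = (fpsX K)%:F ^ m * (s a)%:F].

Definition is_val w (m : int) : Prop :=
  lattice m w /\ forall m', lattice m' w -> (m' <= m)%R.

(* The integer is_val w exists for every w != 0: see val_tP. *)
Definition val_t w : \bar int :=
  if w == 0 then +oo%E else (xget 0 (is_val w))%:E.

Lemma val_tP w : w != 0 -> exists2 m, val_t w = m%:E & is_val w m.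
Proof.
move=> w0; rewrite /val_t (negPf w0).
suff [m wm] : exists m, is_val w m.
  by exists (xget 0 (is_val w)) => //; exact: xgetI wm.
have X0 : (fpsX K)%:F != 0 by rewrite tofrac_eq0 fpsX_neq0.
have /choice[c wc] a : exists c : int, exists s, w a = (fpsX K)%:F ^ c * s%:F.
  have [->|/laurent_factor[c [u [_ ->]]]] := eqVneq (w a) 0.
    by exists 0, 0; rewrite tofrac0 mulr0.
  by exists c, u.
have {wc} /choice[s ws] := wc.
pose m0 : int := - \sum_a `|c a|.
have m0P : lattice m0 w.
  exists (fun a => fpsX K ^+ `|c a - m0|%N * s a) => a.
  rewrite tofracM tofracXn mulrA exprnP -expfzDr // ws gez0_abs.
    by rewrite [m0 + _]addrC subrK.
  rewrite /m0 opprK (bigD1 a) //= addrA addr_ge0 ?sumr_ge0 //.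
  by rewrite -lerBlDl sub0r -normrN ler_norm.
have [b wb0] : exists b, w b != 0.
  apply: contrapT => /forallNP wz; case/eqP: w0; apply/ffunP => b.
  by rewrite ffunE; apply/eqP/negPn/negP/wz.
have [B [u [u0 wbE]]] := laurent_factor wb0.
have leB m : lattice m w -> m <= B.
  move=> [s' /(_ b)]; rewrite wbE => E; rewrite leNgt; apply/negP => ltBm.
  have : u = fpsX K ^+ `|m - B|%N * s' b.
    apply/eqP; rewrite -tofrac_eq tofracM tofracXn exprnP gez0_abs ?subr_ge0 ?ltW //.
    rewrite -(inj_eq (mulfI (expfz_neq0 B X0))) mulrA -expfzDr //.
    by rewrite [B + _]addrC subrK E.
  move=> /(congr1 (fun f => coefs f 0%N)); rewrite coefs_mulXn.
  by rewrite absz_gt0 subr_eq0 gt_eqF // => /eqP; apply/negP.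
have exn : exists n : nat, `[< lattice (m0 + n%:Z) w >].
  by exists 0%N; apply/asboolP; rewrite addr0.
have bnd (n : nat) : `[< lattice (m0 + n%:Z) w >] -> (n <= `|B - m0|)%N.
  move=> /asboolP/leB; rewrite -lerBrDl -lez_nat => /le_trans; apply.
  exact: ler_norm.
case: (ex_maxnP exn bnd) => N /asboolP NP Nmax; exists (m0 + N%:Z); split=> // m mP.
have [lemm|/ltW lem] := leP m m0.
  by apply: le_trans lemm _; rewrite lerDl.
have := Nmax `|m - m0|%N; rewrite gez0_abs ?subr_ge0 // [m0 + _]addrC subrK.
by move=> /(_ (asboolT mP)); rewrite -lez_nat gez0_abs ?subr_ge0 // lerBlDl.
Qed.

End Valuation.

Definition val_t1 (K : fieldType) (f : laurent K) : \bar int :=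
  val_t [ffun _ : unit => f].

(* V_1 (x) ... (x) V_d with V_i = R^(n i), in coordinates: the entry at s is
   the coefficient of the basis tensor [s 1] (x) ... (x) [s d]. *)
Definition multi_index d (n : 'I_d -> nat) := {dffun forall i : 'I_d, 'I_(n i)}.
Notation tensor n R := {ffun multi_index n -> R}.

Section Tensors.
Variables (d : nat) (n : 'I_d -> nat).

Definition pure_tensor (R : comPzRingType) (x : forall i, 'cV[R]_(n i)) :
  tensor n R := [ffun s : multi_index n => \prod_i x i (s i) 0].

(* g_1 (x) ... (x) g_d *)
Definition tensor_act (R : comPzRingType) (g : forall i, 'M[R]_(n i))
    (v : tensor n R) : tensor n R :=
  [ffun s : multi_index n =>
     \sum_(s' : multi_index n) (\prod_i g i (s i) (s' i)) * v s'].

Section Ranks.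
Variable K : fieldType.
Notation V := (tensor n K).

(* V_1 (x) ... (x) V_(i-1) (x) w (x) V_(i+1) (x) ... (x) V_d *)
Definition slice_space (i : 'I_d) (w : 'cV[K]_(n i)) : set V :=
  [set u | exists m (x : 'I_m -> forall k, 'cV[K]_(n k)),
     (forall l, exists a : K, x l i = a *: w) /\
     u = \sum_(l < m) pure_tensor (x l)].

Definition slice_rank1 : set V :=
  [set u | u != 0 /\ exists i w, @slice_space i w u].

Definition Tslice_rank1 : set V :=
  [set u | exists i (j : 'I_(n i)), @slice_space i (delta_mx j 0) u].

Definition sum_lengths (S : set V) (v : V) : set nat :=
  [set r | exists u : 'I_r -> V, (forall k, S (u k)) /\ v = \sum_(k < r) u k].

Definition srk (v : V) : nat := least (sum_lengths slice_rank1 v).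
Definition srkT (v : V) : nat := least (sum_lengths Tslice_rank1 v).

Lemma tensor_pure (v : V) (i0 : 'I_d) (S : set V) :
  (forall x : forall k, 'cV[K]_(n k), pure_tensor x != 0 ->
     (exists (c : K) (j : 'I_(n i0)), x i0 = c *: delta_mx j 0) ->
     S (pure_tensor x)) ->
  sum_lengths S v !=set0.
Proof.
move=> S1; pose A := [set s | v s != 0]%SET.
pose x s k : 'cV[K]_(n k) := (if k == i0 then v s else 1) *: delta_mx (s k) 0.
have xE s : pure_tensor (x s) = [ffun s' => v s *+ (s' == s)].
  apply/ffunP => s'; rewrite !ffunE; have [->|] := eqVneq s' s.
    rewrite (bigD1 i0) //= big1 ?mulr1 => [|k /negPf ki].
      by rewrite !mxE !eqxx mulr1.
    by rewrite !mxE !eqxx ki mulr1.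
  move=> s's; have [k ks] : exists k, s' k != s k.
    apply: contrapT => /forallNP E; case/eqP: s's; apply/ffunP => k.
    by apply/eqP/negPn/negP/E.
  by rewrite (bigD1 k) //= !mxE (negPf ks) mulr0 mul0r.
exists #|A|, (fun k => pure_tensor (x (enum_val k))); split=> [k|].
  apply: S1; last by exists (v (enum_val k)), (enum_val k i0); rewrite /x eqxx.
  have := enum_valP k; rewrite inE; apply: contraNneq; rewrite xE.
  by move=> /ffunP/(_ (enum_val k)); rewrite !ffunE eqxx mulr1n => E; apply/eqP.
rewrite -(big_enum_val (fun s => pure_tensor (x s))) /=; apply/ffunP => s'.
rewrite sum_ffunE; under eq_bigr do rewrite xE ffunE.
have [vs|vs] := eqVneq (v s') 0.
  rewrite vs big1 // => s _; case: eqVneq => // <-.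
  by rewrite vs.
rewrite (bigD1 s') ?inE //= eqxx big1 ?addr0 // => s /andP[_].
by rewrite eq_sym => /negPf ->.
Qed.

Lemma srkP (v : V) : (0 < d)%N -> sum_lengths slice_rank1 v (srk v) /\
  forall r, sum_lengths slice_rank1 v r -> (srk v <= r)%N.
Proof.
move=> d0; apply: leastP; apply: (@tensor_pure v (Ordinal d0)) => x x0 _.
split=> //; exists (Ordinal d0), (x (Ordinal d0)), 1%N, (fun=> x).
split; last by rewrite big_ord1.
by move=> _; exists 1; rewrite scale1r.
Qed.

Lemma srkTP (v : V) : (0 < d)%N -> sum_lengths Tslice_rank1 v (srkT v) /\
  forall r, sum_lengths Tslice_rank1 v r -> (srkT v <= r)%N.
Proof.
move=> d0; apply: leastP; apply: (@tensor_pure v (Ordinal d0)).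
move=> x _ [c [j xj]]; exists (Ordinal d0), j, 1%N, (fun=> x).
by split; [exists c | rewrite big_ord1].
Qed.

Definition in_G (g : forall i, 'M[fps K]_(n i)) : Prop :=
  forall i, map_mx (@FracField.tofrac _) (g i) \in unitmx.

Definition act_laurent (g : forall i, 'M[fps K]_(n i)) (v : V) :
    tensor n (laurent K) :=
  tensor_act (fun i => map_mx (@FracField.tofrac _) (g i))
             [ffun s => (fpsC (v s))%:F].

Definition diag_t (x : forall i, 'I_(n i) -> nat) (i : 'I_d) :
  'M[fps K]_(n i) := diag_mx (\row_j fpsX K ^+ x i j).

Variable R : realType.

Definition ereal_of_int (m : \bar int) : \bar R := er_map (fun k : int => k%:~R) m.

(* On extended reals, x / +oo = 0. *)
Definition mu (g : forall i, 'M[fps K]_(n i)) (v : V) : \bar R :=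
  ((\sum_(i < d)
      ereal_of_int (val_t1 (\det (map_mx (@FracField.tofrac _) (g i)))))
    / ereal_of_int (val_t (act_laurent g v)))%E.

Definition rkG (v : V) : \bar R :=
  ereal_inf [set mu g v | g in
    [set g | in_G g /\ (0%:E < val_t (act_laurent g v))%E]].

Definition rkT (v : V) : \bar R :=
  ereal_inf [set mu (diag_t x) v | x in
    [set x | (0%:E < val_t (act_laurent (diag_t x) v))%E]].

End Ranks.
End Tensors.

(* Main.v *)
Require Import Defs.
From HB Require Import structures.
From mathcomp Require Import all_boot all_order all_algebra.
From mathcomp Require Import constructive_ereal reals.
From mathcomp Require Import perm boolp ereal zify.
Import Order.TTheory GRing.Theory Num.Theory.
Local Open Scope ring_scope.

Set Implicit Arguments.
Unset Strict Implicit.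
Unset Printing Implicit Defensive.

(** The first inequality is the theorem of Lovasz that the integrality gap of
    covers of a d-partite hypergraph is at most d / 2. The support of v is
    such a hypergraph: its vertices are the cells (i, j), and an index s is
    the edge formed of the cells (i, s i). A set of cells that meets every
    edge decomposes v into that many tensors of T-slice rank 1
    ([srkT_le_cover]). Exponents x i j with valuation m > 0 at v satisfy
    x 1 (s 1) + .. + x d (s d) >= m on every edge, so that x / m is a
    fractional cover, and mu is its total weight. It is rounded by comparing
    x i j / m with a random threshold that depends on i only: if the
    thresholds add up to at most 1 then the cells above their threshold cover
    all edges, and if each threshold is uniform on [0, 2 / d] then the
    expected number of these cells is at most d / 2 times the total weight.
    Such dependent uniform variables exist for every d >= 2; a discrete
    version avoids integration ([threshold_family],
    [fractional_cover_rounding]).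

    For the second inequality, write g i = A i * t^(x i) * B i with A i and
    B i invertible over K[[t]], the Smith normal form ([fps_smith]). The
    factor A affects neither the valuation of g v nor those of the
    determinants. The constant term of B v is v' = B(0) v, and every index in
    the support of v' has weight at least the valuation of g v; so the
    rounding argument applies to v' and gives mu >= 2 / d * srkT v'
    ([srkT_at0_le_mu]). As B(0) is invertible over K, srk v <= srkT v'
    ([srk_le_srkT_act]). *)

(** * The action on tensors in coordinates *)

Lemma multi_index_neq d (n : 'I_d -> nat) (s s' : multi_index n) :
  s != s' -> exists i, s i != s' i.
Proof.
move=> ss'; apply: contrapT => /forallNP E; case/eqP: ss'; apply/ffunP => i.
by apply/eqP/negPn/negP/E.
Qed.

(** Distributivity of products over sums when the range of summation depends
    on the factor; this is what makes the action on coordinate tensors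
    multiplicative. It comes from the non-dependent version by summing over
    functions into the disjoint union of the ranges. *)
Lemma big_distr_dffun (R : comPzRingType) d (n : 'I_d -> nat)
    (F : forall i, 'I_(n i) -> R) :
  \prod_i \sum_j F i j = \sum_(s : multi_index n) \prod_i F i (s i).
Proof.
pose P i : {ffun 'I_(n i) -> R} := [ffun j => F i j].
rewrite (reindex (@dffun_of_fprod _ _)) /=; last first.
  exact/onW_bij/dffun_of_fprod_bij.
pose T i : finType := 'I_(n i).
transitivity (\sum_(t : fprod T) \prod_(i in 'I_d) P i (t i)).
  rewrite (@big_fprod R 0 1 *%R +%R _ _ P).
  rewrite -(bigA_distr_big_dep (tagged_with T) (fun i => untag 0 (P i))).
  apply: eq_bigr => i _; rewrite -(@big_tag R 0 +%R _ _ P) /=.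
  by apply: eq_bigr => j _; rewrite ffunE.
by apply: eq_bigr => t _; apply: eq_bigr => i _; rewrite !ffunE.
Qed.

Lemma tensor_actM (R : comPzRingType) d (n : 'I_d -> nat)
    (g h : forall i, 'M[R]_(n i)) (v : {ffun multi_index n -> R}) :
  tensor_act (fun i => g i *m h i) v = tensor_act g (tensor_act h v).
Proof.
apply/ffunP => s; rewrite !ffunE.
under [RHS]eq_bigr do rewrite ffunE mulr_sumr.
rewrite exchange_big /=; apply: eq_bigr => s' _.
under eq_bigr do rewrite mxE.
rewrite big_distr_dffun mulr_suml; apply: eq_bigr => s'' _.
by rewrite big_split mulrA.
Qed.

Lemma tensor_act_diag (R : comPzRingType) d (n : 'I_d -> nat)
    (y : forall i, 'rV[R]_(n i)) (v : {ffun multi_index n -> R}) s :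
  tensor_act (fun i => diag_mx (y i)) v s = (\prod_i y i 0 (s i)) * v s.
Proof.
rewrite ffunE (bigD1 s) //= [X in _ + X]big1 ?addr0 => [|s' s's].
  by congr (_ * _); apply: eq_bigr => i _; rewrite mxE eqxx.
have [i si] := multi_index_neq s's.
by rewrite (bigD1 i) //= mxE eq_sym (negPf si) !mul0r.
Qed.

Lemma tensor_act1 (R : comPzRingType) d (n : 'I_d -> nat)
    (v : {ffun multi_index n -> R}) :
  tensor_act (fun i => 1%:M) v = v.
Proof.
apply/ffunP => s.
rewrite (_ : (fun i => 1%:M) = (fun i => diag_mx (const_mx 1) : 'M[R]_(n i))).
  by rewrite tensor_act_diag big1 ?mul1r // => i _; rewrite mxE.
by apply: functional_extensionality_dep => i; rewrite diag_const_mx.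
Qed.

Lemma tensor_act_pure (R : comPzRingType) d (n : 'I_d -> nat)
    (g : forall i, 'M[R]_(n i)) (x : forall i, 'cV[R]_(n i)) :
  tensor_act g (pure_tensor x) = pure_tensor (fun i => g i *m x i).
Proof.
apply/ffunP => s; rewrite !ffunE.
under [RHS]eq_bigr do rewrite mxE.
rewrite big_distr_dffun; apply: eq_bigr => s' _.
by rewrite ffunE big_split.
Qed.

Lemma tensor_act_sum (R : comPzRingType) d (n : 'I_d -> nat)
    (g : forall i, 'M[R]_(n i)) (I : finType)
    (u : I -> {ffun multi_index n -> R}) :
  tensor_act g (\sum_k u k) = \sum_k tensor_act g (u k).
Proof.
apply/ffunP => s; rewrite ffunE sum_ffunE.
under [RHS]eq_bigr do rewrite ffunE.
rewrite exchange_big /=; apply: eq_bigr => s' _.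
by rewrite sum_ffunE mulr_sumr.
Qed.

Lemma tensor_act_map (R S : comPzRingType) (f : {rmorphism R -> S}) d
    (n : 'I_d -> nat) (g : forall i, 'M[R]_(n i))
    (v : {ffun multi_index n -> R}) :
  tensor_act (fun i => map_mx f (g i)) [ffun s => f (v s)] =
  [ffun s => f (tensor_act g v s)].
Proof.
apply/ffunP => s; rewrite !ffunE rmorph_sum; apply: eq_bigr => s' _.
rewrite ffunE rmorphM rmorph_prod; congr (_ * _).
by apply: eq_bigr => i _; rewrite mxE.
Qed.

(** * Rounding fractional covers of d-partite hypergraphs *)

Lemma card_lt_injective N (t : 'I_N -> nat) (y : nat) :
  injective t -> (#|[set u | (t u < y)%N]| <= y)%N.
Proof.
move=> t_inj.
rewrite cardE -(size_map t) -[X in (_ <= X)%N](size_iota 0 y).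
apply: uniq_leq_size; first by rewrite map_inj_uniq ?enum_uniq.
by move=> k /mapP[u]; rewrite mem_enum inE mem_iota => ut ->.
Qed.

(** For u uniform in 'I_(2 * m), the values t i u constructed here are uniform
    on 0, .., 2m - 1, which is used through injectivity only. Their mean is
    m - 1/2, so the mean of their sum is d * m - d / 2; the point is to stay
    below d * m for every u at once. For two variables, u and 2m - 1 - u have
    constant sum 2m - 1. For three variables, add to u its cyclic shift by m
    and what is missing to 3m - 1 if u < m, to 3m - 2 if m <= u: this last
    variable runs through the odd numbers in the first case and through the
    even ones in the second. Larger d add complementary pairs. *)
Lemma threshold_family d m : (2 <= d)%N -> (0 < m)%N ->
  exists t : nat -> 'I_(2 * m) -> nat, (forall i, injective (t i)) /\
    forall u, (\sum_(i < d) t i u < d * m)%N.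
Proof.
move=> d2 m0.
have [k [b dE]] : exists k (b : bool), d = (k.*2 + (b + 2))%N.
  by exists ((d - 2)./2), (odd (d - 2)); move: (odd_double_half (d - 2)); lia.
rewrite {d}dE in d2 *; move: d2 => _.
elim: k => [|k [t [t_inj t_sum]]].
  case: b => /=; last first.
    exists (fun i (u : 'I_(2 * m)) =>
      if i is 0 then u : nat else (2 * m - 1 - u)%N).
    split=> [[|i] u w /= uw | u];
      try by apply: ord_inj; move: (ltn_ord u) (ltn_ord w); lia.
    by rewrite 2!big_ord_recr big_ord0 /=; move: (ltn_ord u); lia.
  pose q (u : 'I_(2 * m)) := if (u < m)%N then (u + m)%N else (u - m)%N.
  pose r (u : 'I_(2 * m)) := if (u < m)%N then (2 * m - 1 - u.*2)%N
    else (4 * m - 2 - u.*2)%N.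
  exists (fun i (u : 'I_(2 * m)) =>
    if i is 0 then u : nat else if i is 1 then q u else r u).
  split=> [[|[|i]] u w | u]; first by move=> uw; apply: ord_inj.
  - by rewrite /= /q; case: (ltnP u m); case: (ltnP w m) => *; apply: ord_inj;
      move: (ltn_ord u) (ltn_ord w); lia.
  - by rewrite /= /r; case: (ltnP u m); case: (ltnP w m) => *; apply: ord_inj;
      move: (ltn_ord u) (ltn_ord w); lia.
  by rewrite 3!big_ord_recr big_ord0 /= /q /r; case: (ltnP u m);
    move: (ltn_ord u); lia.
exists (fun i (u : 'I_(2 * m)) => if i is 0 then u : nat else
                   if i is i'.+2 then t i' u else (2 * m - 1 - u)%N).
split=> [[|[|i]] u w /= uw | u].
- exact: ord_inj.
- by apply: ord_inj; move: (ltn_ord u) (ltn_ord w); lia.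
- exact: t_inj uw.
rewrite doubleS 2!addSn 2!big_ord_recl /=.
rewrite [X in (_ < X)%N]mulSn [X in (_ < _ + X)%N]mulSn.
under eq_bigr do rewrite add0n.
move: (t_sum u) (ltn_ord u).
move: (\sum_(i < _) t i u)%N (_ * m)%N => T D.
by lia.
Qed.

(** The bound d / 2 on the integrality gap of covers of d-partite
    hypergraphs. A cell (i, j) is kept when d * x i j exceeds the i-th
    threshold; since the thresholds add up to less than d * m, no s of S can
    stay below all of them. On average over u, a cell of weight x i j is kept
    for at most d * x i j of the 2 * m values of u, and the best u does at
    least as well as the average. *)
Lemma fractional_cover_rounding d (n : 'I_d -> nat) (S : multi_index n -> Prop)
    (x : forall i, 'I_(n i) -> nat) m : (2 <= d)%N -> (0 < m)%N ->
    (forall s, S s -> (m <= \sum_i x i (s i))%N) ->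
  exists C : {set {i : 'I_d & 'I_(n i)}},
    (forall s, S s -> exists i, Tagged (fun i => 'I_(n i)) (s i) \in C) /\
    (2 * m * #|C| <= d * \sum_i \sum_j x i j)%N.
Proof.
move=> d2 m0 Sx; have [t [t_inj t_sum]] := threshold_family d2 m0.
pose C u := [set p : {i : 'I_d & 'I_(n i)} |
  (t (tag p) u < d * x (tag p) (tagged p))%N].
have C_cover u s : S s -> exists i, Tagged (fun i => 'I_(n i)) (s i) \in C u.
  move=> /Sx xs; apply: contrapT => /forallNP noC.
  have : (d * m <= \sum_(i < d) t i u)%N.
    apply: (@leq_trans (d * \sum_i x i (s i))).
      by rewrite leq_mul2l xs orbT.
    rewrite big_distrr /=; apply: leq_sum => i _.
    by have /negP := noC i; rewrite inE -leqNgt.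
  by rewrite leqNgt t_sum.
have C_sum : (\sum_u #|C u| <= d * \sum_i \sum_j x i j)%N.
  under eq_bigr do rewrite -sum1dep_card big_mkcond /=.
  rewrite exchange_big big_distrr /=.
  under [X in (_ <= X)%N]eq_bigr do rewrite big_distrr /=.
  rewrite [X in (_ <= X)%N]sig_big_dep /=; apply: leq_sum => p _.
  by rewrite -big_mkcond sum1dep_card card_lt_injective.
have u0 : 'I_(2 * m) by exists 0%N; lia.
have [u _ u_min] := @arg_minnP _ u0 xpredT (fun u => #|C u|) isT.
exists (C u); split=> [s|]; first exact: C_cover.
apply: leq_trans C_sum; have -> : (2 * m * #|C u| = \sum_(w < 2 * m) #|C u|)%N.
  by rewrite sum_nat_const card_ord.
by apply: leq_sum => w _; apply: u_min.
Qed.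

(** * Slices and covers of the support *)

Lemma slice_space_supported (K : fieldType) d (n : 'I_d -> nat) (i : 'I_d)
    (j : 'I_(n i)) (u : {ffun multi_index n -> K}) :
  (forall s, u s != 0 -> s i = j) -> slice_space (delta_mx j 0) u.
Proof.
move=> u_supp.
pose c s k : K := if k == i then u s else 1.
pose x s k : 'cV[K]_(n k) := c s k *: delta_mx (s k) 0.
exists #|{: multi_index n}|, (fun l => x (enum_val l)); split=> [l|].
  rewrite /x /c eqxx; have [->|us] := eqVneq (u (enum_val l)) 0.
    by exists 0; rewrite !scale0r.
  by exists (u (enum_val l)); rewrite (u_supp _ us).
rewrite -(big_enum_val (fun s => pure_tensor (x s))) /=.
apply/ffunP => s.
rewrite sum_ffunE (bigD1 s) //= [X in _ + X]big1 ?addr0 => [|s' s's].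
  rewrite ffunE (bigD1 i) //= big1 ?mulr1 /x /c => [|k /negPf ki].
    by rewrite !mxE !eqxx mulr1.
  by rewrite !mxE !eqxx ki mulr1.
rewrite ffunE; have [k sk] := multi_index_neq s's.
by rewrite (bigD1 k) //= !mxE eq_sym (negPf sk) mulr0 mul0r.
Qed.

(** Cells (i, j) that meet every index in the support cut the tensor into as
    many pieces of T-slice rank 1: give each index of the support to one cell
    that it passes through. *)
Lemma srkT_le_cover (K : fieldType) d (n : 'I_d -> nat)
    (v : {ffun multi_index n -> K}) (C : {set {i : 'I_d & 'I_(n i)}}) :
  (0 < d)%N ->
  (forall s, v s != 0 -> exists i, Tagged (fun i => 'I_(n i)) (s i) \in C) ->
  (srkT v <= #|C|)%N.
Proof.
move=> d0 C_cover; have [_] := srkTP v d0; apply.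
pose hit (s : multi_index n) i := Tagged (fun i => 'I_(n i)) (s i) \in C.
pose i0 := Ordinal d0.
(* Off the support, the cell of coordinate i0 is a dummy: v vanishes there. *)
pose cell (s : multi_index n) : {i : 'I_d & 'I_(n i)} :=
  let i := odflt i0 [pick i | hit s i] in Tagged (fun i => 'I_(n i)) (s i).
have cellC s : v s != 0 -> cell s \in C.
  move=> /C_cover[i si]; rewrite /cell; case: pickP => [k //|/(_ i)].
  by rewrite /hit si.
pose part p : {ffun multi_index n -> K} :=
  [ffun s => if cell s == p then v s else 0].
exists (fun k => part (enum_val k)); split=> [k|].
  exists (tag (enum_val k)), (tagged (enum_val k)).
  apply: slice_space_supported => s; rewrite ffunE.
  by case: (cell s =P _) => [<-|_ /eqP].
rewrite /= -(big_enum_val part) /=; apply/ffunP => s; rewrite sum_ffunE.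
under eq_bigr do rewrite ffunE.
have [vs|/cellC sC] := eqVneq (v s) 0.
  by rewrite vs big1 // => p _; rewrite if_same.
rewrite (bigD1 (cell s)) //= eqxx big1 ?addr0 // => p /andP[_].
by rewrite eq_sym => /negPf ->.
Qed.

Lemma slice_space_act (K : fieldType) d (n : 'I_d -> nat)
    (g : forall i, 'M[K]_(n i)) (i : 'I_d) (w : 'cV[K]_(n i))
    (u : {ffun multi_index n -> K}) :
  slice_space w u -> slice_space (g i *m w) (tensor_act g u).
Proof.
move=> [m [x [xw ->]]]; exists m, (fun l k => g k *m x l k); split=> [l|].
  by have [a ->] := xw l; exists a; rewrite scalemxAr.
by rewrite tensor_act_sum; apply: eq_bigr => l _; rewrite tensor_act_pure.
Qed.

(** Zero summands, which do not have slice rank 1, are dropped from the sum: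
    hence an inequality. *)
Lemma srk_le_sum (K : fieldType) d (n : 'I_d -> nat) r
    (u : 'I_r -> {ffun multi_index n -> K}) : (0 < d)%N ->
  (forall k, exists i (w : 'cV[K]_(n i)), slice_space w (u k)) ->
  (srk (\sum_k u k)%R <= r)%N.
Proof.
move=> d0 u_slice; pose A := [set k | u k != 0].
apply: (@leq_trans #|A|); last by rewrite -[X in (_ <= X)%N]card_ord max_card.
have [_] := srkP (\sum_k u k) d0; apply.
exists (fun k => u (enum_val k)); split=> [k|].
  by split; [have := enum_valP k; rewrite inE | exact: u_slice].
rewrite -(big_enum_val u) /= big_mkcond [RHS]big_mkcond /=.
by apply: eq_bigr => k _; rewrite inE; case: eqP => [->|].
Qed.

(** A change of basis turns coordinate slices into slices along arbitrary
    vectors, so the slice rank is a lower bound for the T-slice rank in every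
    system of bases. *)
Lemma srk_le_srkT_act (K : fieldType) d (n : 'I_d -> nat)
    (g : forall i, 'M[K]_(n i)) (v : {ffun multi_index n -> K}) :
  (0 < d)%N -> (forall i, g i \in unitmx) ->
  (srk v <= srkT (tensor_act g v))%N.
Proof.
move=> d0 g_unit; have [[u [uS gvE]] _] := srkTP (tensor_act g v) d0.
have vE : v = \sum_k tensor_act (fun i => invmx (g i)) (u k).
  rewrite -tensor_act_sum -gvE -tensor_actM -[LHS]tensor_act1.
  congr (tensor_act _ v); apply: functional_extensionality_dep => i.
  by rewrite mulVmx.
rewrite [X in (srk X <= _)%N]vE; apply: srk_le_sum => // k.
have [i [j ujk]] := uS k.
by exists i, (invmx (g i) *m delta_mx j 0); apply: slice_space_act.
Qed.

(** * Smith normal form over power series *)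

Definition fps_at0 (K : fieldType) (f : fps K) : K := coefs f 0%N.

Fact fps_at0_is_zmod_morphism (K : fieldType) : zmod_morphism (@fps_at0 K).
Proof. by []. Qed.

Fact fps_at0_is_monoid_morphism (K : fieldType) : monoid_morphism (@fps_at0 K).
Proof.
by split=> // f g; rewrite /fps_at0 coefsM big_ord_recl big_ord0 addr0.
Qed.

HB.instance Definition _ (K : fieldType) :=
  GRing.isZmodMorphism.Build (fps K) K (@fps_at0 K)
    (@fps_at0_is_zmod_morphism K).
HB.instance Definition _ (K : fieldType) :=
  GRing.isMonoidMorphism.Build (fps K) K (@fps_at0 K)
    (@fps_at0_is_monoid_morphism K).

Lemma fps_unitE (K : fieldType) (f : fps K) :
  (f \is a GRing.unit) = (fps_at0 f != 0).
Proof.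
apply/idP/idP => [/(rmorph_unit (@fps_at0 K))|f0]; first by rewrite unitfE.
by have [g gf1] := fps_unit0 f0; apply/unitrPr; exists g; rewrite mulrC.
Qed.

(** Smith normal form over the discrete valuation ring K[[t]]. An entry of
    least order a divides all the others; dividing by t^a and moving it to
    the corner makes it a unit, which clears its row and its column. *)
Lemma fps_smith (K : fieldType) n (M : 'M[fps K]_n) :
  exists (A B : 'M[fps K]_n) (D : 'rV[fps K]_n),
    [/\ A \in unitmx, B \in unitmx,
        forall j, D 0 j = 0 \/ exists k, D 0 j = fpsX K ^+ k
      & M = A *m diag_mx D *m B].
Proof.
elim: n M => [|n IH] M.
  exists 1%:M, 1%:M, 0; rewrite !unitmx1; split=> // [j|]; first by case: j.
  by rewrite [LHS]thinmx0 [RHS]thinmx0.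
have [->|M0] := eqVneq M 0.
  exists 1%:M, 1%:M, 0; rewrite !unitmx1.
  split=> // [j|]; first by left; rewrite mxE.
  by rewrite linear0 mulmx0 mul0mx.
(* The least order a of an entry of M, reached at (i0, j0). *)
have [a [i0 [j0 [Ma0 Mlt]]]] : exists a i0 j0, coefs (M i0 j0) a != 0 /\
    forall i j k, (k < a)%N -> coefs (M i j) k = 0.
  have exa : exists a, [exists i, exists j, coefs (M i j) a != 0].
    apply: contrapT => /forallNP Mz; case/eqP: M0; apply/matrixP => i j.
    rewrite mxE; apply: fpsP => k /=; rewrite if_same.
    apply/eqP/negPn/negP => Mk.
    by apply: (Mz k); apply/existsP; exists i; apply/existsP; exists j.
  case: (ex_minnP exa) => a /existsP[i0 /existsP[j0 Ma]] amin.
  exists a, i0, j0; split=> // i j k ka; apply/eqP/negPn/negP => Mk.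
  have /amin : [exists i, exists j, coefs (M i j) k != 0].
    by apply/existsP; exists i; apply/existsP; exists j.
  by rewrite leqNgt ka.
pose M1 : 'M[fps K]_n.+1 := \matrix_(i, j) Fps (fun k => coefs (M i j) (k + a)).
have M_M1 : M = fpsX K ^+ a *: M1.
  apply/matrixP => i j; rewrite !mxE; apply: fpsP => k; rewrite coefs_mulXn /=.
  by case: ltnP => [/Mlt ->|ak] //; rewrite subnK.
pose P := tperm_mx i0 0 : 'M[fps K]_n.+1.
pose Q := tperm_mx j0 0 : 'M[fps K]_n.+1.
have PP : P *m P = 1%:M by rewrite /P /tperm_mx -perm_mxM tperm2 perm_mx1.
have QQ : Q *m Q = 1%:M by rewrite /Q /tperm_mx -perm_mxM tperm2 perm_mx1.
pose M2 : 'M[fps K]_(1 + n) := P *m M1 *m Q.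
have M1E : M1 = P *m M2 *m Q by rewrite /M2 !mulmxA PP mul1mx -mulmxA QQ mulmx1.
pose u := M2 0 0.
have u_unit : u \is a GRing.unit.
  rewrite fps_unitE /u /M2 -xcolE -xrowE !mxE !tpermR /= /fps_at0 /=.
  by rewrite add0n.
pose c := dlsubmx M2; pose r := ursubmx M2.
pose N := drsubmx M2 - c *m (u^-1 *: r).
(* Clearing row and column leaves the Schur complement N of the corner. *)
have M2E : M2 = block_mx 1%:M 0 (u^-1 *: c) 1%:M *m block_mx u%:M 0 0 N
                  *m block_mx 1%:M (u^-1 *: r) 0 1%:M.
  rewrite 2!mulmx_block !mul1mx !mulmx1 !mulmx0 !mul0mx !addr0 !add0r.
  rewrite mul_scalar_mx scalerA mulrV // scale1r.
  rewrite mul_mx_scalar scalerA mulrV // scale1r.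
  rewrite /N addrC subrK -[LHS]submxK; congr block_mx.
  by rewrite [LHS]mx11_scalar 2![in LHS]mxE !lshift0.
have [A [B [D [A_unit B_unit D_pow NE]]]] := IH N.
pose L := block_mx 1%:M 0 (u^-1 *: c) 1%:M : 'M_(1 + n).
pose U := block_mx 1%:M (u^-1 *: r) 0 1%:M : 'M_(1 + n).
pose A' := block_mx u%:M 0 0 A : 'M_(1 + n).
pose B' := block_mx 1%:M 0 0 B : 'M_(1 + n).
have L_unit : L \in unitmx by rewrite unitmxE det_lblock !det1 mulr1 unitr1.
have U_unit : U \in unitmx by rewrite unitmxE det_ublock !det1 mulr1 unitr1.
have A'_unit : A' \in unitmx.
  by rewrite unitmxE det_ublock det_scalar1 unitrM u_unit -unitmxE.
have B'_unit : B' \in unitmx by rewrite unitmxE det_ublock det1 mul1r -unitmxE.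
exists (P *m (L *m A')), (B' *m U *m Q),
  (fpsX K ^+ a *: row_mx 1%:M D).
have P_unit : P \in unitmx by case: (mulmx1_unit PP).
have Q_unit : Q \in unitmx by case: (mulmx1_unit QQ).
split.
- by clearbody P L A'; rewrite !unitmx_mul P_unit L_unit.
- by clearbody Q U B'; rewrite !unitmx_mul Q_unit U_unit B'_unit.
- move=> j; rewrite mxE; case: (@split_ordP 1 n j) => k ->.
    by right; exists a; rewrite row_mxEl [k]ord1 !mxE mulr1.
  rewrite row_mxEr; have [->|[b ->]] := D_pow k; first by left; rewrite mulr0.
  by right; exists (a + b)%N; rewrite exprD.
rewrite M_M1 M1E; rewrite [M2 in LHS]M2E -/L -/U NE.
have DE : diag_mx (row_mx 1%:M D : 'rV_(1 + n)) = block_mx 1%:M 0 0 (diag_mx D).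
  rewrite diag_mx_row; congr block_mx; apply/matrixP => i j.
  by rewrite !mxE !ord1 !eqxx.
transitivity (fpsX K ^+ a *:
    (P *m (L *m A' *m block_mx 1%:M 0 0 (diag_mx D) *m B' *m U) *m Q)).
  have -> : block_mx u%:M 0 0 (A *m diag_mx D *m B) =
      A' *m (block_mx 1%:M 0 0 (diag_mx D) *m B').
    rewrite !mulmx_block !(mul1mx, mulmx1, mulmx0, mul0mx, addr0, add0r).
    by rewrite mulmxA.
  move: (block_mx 1%:M 0 0 (diag_mx D)) => X.
  by clearbody P Q L U A' B'; rewrite !mulmxA.
rewrite -DE; clearbody P Q L U A' B'; rewrite linearZ /=.
move: (diag_mx _) => X.
by rewrite -!scalemxAr -!scalemxAl !mulmxA.
Qed.

Lemma fps_smith_det (K : fieldType) n (M : 'M[fps K]_n) : \det M != 0 ->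
  exists (A B : 'M[fps K]_n) (x : 'I_n -> nat),
    [/\ A \in unitmx, B \in unitmx
      & M = A *m diag_mx (\row_j fpsX K ^+ x j) *m B].
Proof.
have [A [B [D [A_unit B_unit D_pow ->]]]] := fps_smith M.
rewrite !det_mulmx det_diag => D0.
have /choice[x xD] j : exists k, D 0 j = fpsX K ^+ k.
  have [Dj|//] := D_pow j; move: D0.
  by rewrite (bigD1 j) //= Dj mul0r mulr0 mul0r eqxx.
exists A, B, x; split; [by [] | by [] |]; congr (_ *m diag_mx _ *m _).
by apply/rowP => j; rewrite xD mxE.
Qed.

(** * Valuations and the lower bound on mu *)

Lemma val_t_unique (K : fieldType) (I : finType)
    (w : {ffun I -> laurent K}) m : w != 0 -> is_val w m -> val_t w = m%:E.
Proof.
move=> w0 [wm mmax]; have [m' -> [wm' m'max]] := val_tP w0; congr (_%:E).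
by apply/eqP; rewrite eq_le mmax ?m'max.
Qed.

Lemma fpsX_F_neq0 (K : fieldType) : (fpsX K)%:F != 0.
Proof. by rewrite tofrac_eq0 fpsX_neq0. Qed.

Lemma val_t1_monomial (K : fieldType) k (u : fps K) : u \is a GRing.unit ->
  val_t1 (fpsX K ^+ k * u)%:F = k%:Z%:E.
Proof.
rewrite fps_unitE => u0; apply: val_t_unique.
  apply/eqP => /ffunP/(_ tt); rewrite !ffunE => /eqP; rewrite tofrac_eq0.
  rewrite mulf_eq0 expf_eq0 (negPf (fpsX_neq0 K)) andbF /=.
  by move=> /eqP u_eq0; rewrite u_eq0 rmorph0 eqxx in u0.
split=> [|m [s /(_ tt)]].
  by exists (fun=> u) => a; rewrite ffunE tofracM tofracXn.
rewrite ffunE => sE; rewrite leNgt; apply/negP => km.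
have : u = fpsX K ^+ `|m - k|%N * s tt.
  apply/eqP; rewrite -tofrac_eq tofracM tofracXn exprnP.
  rewrite gez0_abs ?subr_ge0 ?ltW //.
  rewrite -(inj_eq (mulfI (expfz_neq0 k (fpsX_F_neq0 K)))) mulrA.
  rewrite -expfzDr ?fpsX_F_neq0 //.
  by rewrite [k%:Z + _]addrC subrK -sE tofracM tofracXn.
move=> /(congr1 (@fps_at0 K)); rewrite /fps_at0 coefs_mulXn.
by rewrite absz_gt0 subr_eq0 gt_eqF // => /eqP; apply/negP.
Qed.

Lemma val_t_gt0_dvd (K : fieldType) (I : finType) (f : I -> fps K) :
  (0%:E < val_t [ffun a => (f a)%:F])%E ->
  (forall a, f a = 0) \/
  exists2 m, (0 < m)%N & val_t [ffun a => (f a)%:F] = m%:Z%:E /\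
    forall a, exists h, f a = fpsX K ^+ m * h.
Proof.
have [w0 _|w0] := eqVneq [ffun a => (f a)%:F] 0.
  left=> a; have /ffunP/(_ a) := w0; rewrite !ffunE => /eqP.
  by rewrite tofrac_eq0 => /eqP.
have [[m|m] -> [[s sE] _]] := val_tP w0; rewrite lte_fin // => m0.
right; exists m => //; split=> // a; exists (s a).
apply/eqP; rewrite -tofrac_eq tofracM tofracXn; apply/eqP.
by rewrite -sE ffunE.
Qed.

Lemma act_laurentE (K : fieldType) d (n : 'I_d -> nat)
    (g : forall i, 'M[fps K]_(n i)) (v : {ffun multi_index n -> K}) :
  act_laurent g v =
    [ffun s => (tensor_act g [ffun s => fpsC (v s)] s)%:F].
Proof.
rewrite -(tensor_act_map (@FracField.tofrac (fps K))) /act_laurent.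
by congr tensor_act; apply/ffunP => s; rewrite !ffunE.
Qed.

Lemma tensor_act_fps_at0 (K : fieldType) d (n : 'I_d -> nat)
    (g : forall i, 'M[fps K]_(n i)) (v : {ffun multi_index n -> K}) s :
  tensor_act (fun i => map_mx (@fps_at0 K) (g i)) v s =
    fps_at0 (tensor_act g [ffun s => fpsC (v s)] s).
Proof.
have /ffunP/(_ s) := tensor_act_map (@fps_at0 K) g [ffun s => fpsC (v s)].
rewrite [RHS]ffunE => <-; congr (tensor_act _ _ s).
by apply/ffunP => s'; rewrite !ffunE.
Qed.

(** An invertible A over K[[t]] does not change divisibility by t^m, so t^m
    divides t^(sum of the x i (s i)) * w s, and the second factor is a unit as
    soon as it does not vanish at t = 0. *)
Lemma le_weight_of_dvd (K : fieldType) d (n : 'I_d -> nat)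
    (A : forall i, 'M[fps K]_(n i)) (x : forall i, 'I_(n i) -> nat)
    (w : {ffun multi_index n -> fps K}) m :
  (forall i, A i \in unitmx) ->
  (forall s, exists h,
     tensor_act (fun i => A i *m diag_t K x i) w s = fpsX K ^+ m * h) ->
  forall s, fps_at0 (w s) != 0 -> (m <= \sum_i x i (s i))%N.
Proof.
move=> A_unit /choice[h hE] s ws.
have : tensor_act (fun i => diag_t K x i) w s =
    fpsX K ^+ m * tensor_act (fun i => invmx (A i)) [ffun s => h s] s.
  transitivity (tensor_act (fun i => invmx (A i))
      (tensor_act (fun i => A i *m diag_t K x i) w) s).
    rewrite -tensor_actM; congr (tensor_act _ _ s).
    by apply: functional_extensionality_dep => i; rewrite mulmxA mulVmx ?mul1mx.
  rewrite !ffunE mulr_sumr; apply: eq_bigr => s' _.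
  by rewrite hE ffunE mulrCA.
rewrite tensor_act_diag; under eq_bigr do rewrite mxE.
rewrite -expr_sum => E; rewrite leqNgt; apply/negP => lt_m.
have /eqP := congr1 (fun f => coefs f (\sum_i x i (s i))%N) E.
by rewrite !coefs_mulXn lt_m ltnn subnn; apply/negP.
Qed.

(** The common core of both inequalities. For g = A t^x B with A and B
    invertible over K[[t]], the numerator of mu is the sum of all the weights
    x i j. The weights of an index in the support of B(0) v add up to at
    least the valuation m of g v, so that x / m is a fractional cover of this
    support. *)
Lemma srkT_at0_le_mu (R : realType) (K : fieldType) d (n : 'I_d -> nat)
    (g A B : forall i, 'M[fps K]_(n i)) (x : forall i, 'I_(n i) -> nat)
    (v : {ffun multi_index n -> K}) :
  (2 <= d)%N -> (forall i, A i \in unitmx) -> (forall i, B i \in unitmx) ->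
  (forall i, g i = A i *m diag_t K x i *m B i) ->
  (0%:E < val_t (act_laurent g v))%E ->
  ((2 / d%:R *
     (srkT (tensor_act (fun i => map_mx (@fps_at0 K) (B i)) v))%:R)%:E
    <= mu R g v)%E.
Proof.
move=> d2 A_unit B_unit gE val_gt0; have d0 : (0 < d)%N by exact: ltnW.
have num : (\sum_(i < d) ereal_of_int R
     (val_t1 (\det (map_mx (@FracField.tofrac _) (g i)))) =
   (\sum_i \sum_j x i j)%:R%:E)%E.
  rewrite natr_sum -sumEFin; apply: eq_bigr => i _.
  rewrite det_map_mx gE !det_mulmx det_diag.
  under eq_bigr do rewrite mxE.
  rewrite -expr_sum mulrAC mulrC val_t1_monomial //.
  by rewrite unitrM -!unitmxE A_unit B_unit.
pose w := tensor_act B [ffun s => fpsC (v s)].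
have fE : tensor_act g [ffun s => fpsC (v s)] =
    tensor_act (fun i => A i *m diag_t K x i) w.
  rewrite /w -tensor_actM; congr tensor_act.
  by apply: functional_extensionality_dep => i; rewrite gE.
set v' := tensor_act _ v.
have v'E s : v' s = fps_at0 (w s) by exact: tensor_act_fps_at0.
rewrite /mu num; move: val_gt0; rewrite act_laurentE fE => val_gt0.
(* Infinite valuation forces B(0) v = 0: its weights would exceed any bound. *)
have [f0|[m m0 [-> dvd_m]]] := val_t_gt0_dvd val_gt0.
  have -> : srkT v' = 0%N.
    apply/eqP; rewrite -leqn0 -(cards0 {i : 'I_d & 'I_(n i)}).
    apply: srkT_le_cover => // s; rewrite v'E => ws.
    have dvd0 s' : exists h, tensor_act (fun i => A i *m diag_t K x i) w s' =
        fpsX K ^+ (\sum_i x i (s i)).+1 * h by exists 0; rewrite f0 mulr0.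
    by have := le_weight_of_dvd A_unit dvd0 ws; rewrite ltnn.
  rewrite mulr0 mule_ge0 ?lee_fin ?ler0n // inve_ge0.
  case: (val_t _) val_gt0 => [k k0||] //; last by rewrite leey.
  by rewrite lee_fin ler0z; apply: ltW k0.
have v'_weight s : v' s != 0 -> (m <= \sum_i x i (s i))%N.
  by rewrite v'E; apply: le_weight_of_dvd A_unit dvd_m s.
have [C [C_cover C_le]] := fractional_cover_rounding d2 m0 v'_weight.
have := leq_trans (leq_mul (leqnn (2 * m)) (srkT_le_cover d0 C_cover)) C_le.
rewrite /ereal_of_int /= -pmulrn inver pnatr_eq0 eqn0Ngt m0 -EFinM.
rewrite lee_fin => le.
rewrite ler_pdivlMr ?ltr0n // mulrAC -mulrA mulrAC ler_pdivrMr ?ltr0n //.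
by rewrite -!natrM ler_nat; lia.
Qed.

(** * The inequalities between the ranks *)

Theorem proposition4p9 (R : realType) (K : fieldType) (hK : perfect_field K)
    (d : nat) (hd : (2 <= d)%N) (n : 'I_d -> nat) (v : tensor n K) :
  ((2 / d%:R * (srkT v)%:R)%:E <= rkT R v)%E /\
  ((2 / d%:R * (srk v)%:R)%:E <= rkG R v)%E.
Proof.
have d0 : (0 < d)%N by exact: ltnW.
split; apply/ereal_infP => y [].
  (* One-parameter subgroups are their own Smith form, with B = 1. *)
  move=> x val_gt0 <-.
  have := @srkT_at0_le_mu R K d n (diag_t K x) (fun=> 1%:M) (fun=> 1%:M) x v hd.
  rewrite (_ : (fun i => map_mx _ _) = fun i => 1%:M); last first.
    by apply: functional_extensionality_dep => i; rewrite map_mx1.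
  by rewrite tensor_act1; apply=> // i; rewrite ?unitmx1 // mul1mx mulmx1.
move=> g [gG val_gt0] <-.
have smith i : {ABx : 'M[fps K]_(n i) * 'M[fps K]_(n i) * ('I_(n i) -> nat) |
    [/\ ABx.1.1 \in unitmx, ABx.1.2 \in unitmx
      & g i = ABx.1.1 *m diag_mx (\row_j fpsX K ^+ ABx.2 j) *m ABx.1.2]}.
  apply: cid; have [|A [B [x ABx]]] := @fps_smith_det K _ (g i).
    by have := gG i; rewrite unitmxE unitfE det_map_mx tofrac_eq0.
  by exists (A, B, x).
pose A i := (projT1 (smith i)).1.1; pose B i := (projT1 (smith i)).1.2.
pose x i := (projT1 (smith i)).2.
have A_unit i : A i \in unitmx by rewrite /A; case: (smith i) => ? [].
have B_unit i : B i \in unitmx by rewrite /B; case: (smith i) => ? [].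
have gE i : g i = A i *m diag_t K x i *m B i.
  by rewrite /A /B /x /diag_t; case: (smith i) => ? [].
apply: le_trans (srkT_at0_le_mu R hd A_unit B_unit gE val_gt0).
rewrite lee_fin ler_wpM2l ?divr_ge0 ?ler0n // ler_nat.
apply: srk_le_srkT_act => // i.
by rewrite unitmxE det_map_mx rmorph_unit -?unitmxE.
Qed.
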